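(* The following two assertions are equivalent. (i) For every discrete metric space $X$ of bounded geometry, $X$ has naive property A if and only if $X$ has property A. (ii) For every discrete metric space $X$ of bounded geometry with naive property A, every subspace $Y\subseteq X$ (with the restricted metric) has naive property A.
   Context: Let $(X,d)$ be a discrete metric space. For $x\in X$ and $R>0$ write $B(x,R):=\{y\in X: d(y,x)\le R\}$. $X$ has *bounded geometry* if $\sup_{x\in X}|B(x,R)|<\infty$ for every $R>0$. $X$ has *property A* if for any $R,\varepsilon>0$ there exists a family $\{A_x\}_{x\in X}$ of finite, non-empty subsets of $X\times\mathbb{N}$ such that: (1) for any $x,y\in X$ with $d(x,y)\le R$, $\frac{|A_x\triangle A_y|}{|A_x\cap A_y|}<\varepsilon$; (2) there exists $S>0$ such that for any $x\in X$ and any $(y,n)\in A_x$, $d(x,y)\le S$. $X$ has *naive property A* if for any $R,\varepsilon>0$ there exists a family $\{A_x\}_{x\in X}$ of finite, non-empty subsets of $X$ such that: (1) for any $x,y\in X$ with $d(x,y)\le R$, $\frac{|A_x\triangle A_y|}{|A_x\cap A_y|}<\varepsilon$; (2) there exists $S>0$ such that for any $x\in X$ and any $y\in A_x$, $d(x,y)\le S$. In both definitions, the inequality in (1) is understood to include that $A_x\cap A_y\neq\emptyset$. *)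

(* Defs.v *)
From HB Require Import structures.
From mathcomp Require Import all_boot all_order all_algebra finmap.
From mathcomp Require Import boolp classical_sets functions cardinality.
From mathcomp Require Import reals topology.

Set Implicit Arguments.
Unset Strict Implicit.
Unset Printing Implicit Defensive.

Import Order.TTheory GRing.Theory Num.Theory.

Local Open Scope classical_set_scope.
Local Open Scope ring_scope.

(* [set_type Y] already carries the restricted pseudometric; this completes it
   to a [metricType] whose distance is the restriction of that of [X]. *)
Section SubspaceMetric.
Context {R : realType} {X : metricType R} (Y : set X).

Definition sub_mdist (x y : set_type Y) : R := mdist (\val x) (\val y).

Fact sub_mdist_ge0 x y : 0 <= sub_mdist x y.
Proof. exact: mdist_ge0. Qed.

Fact sub_mdist_positivity x y : sub_mdist x y = 0 -> x = y.
Proof. by move=> /mdist_positivity /val_inj. Qed.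

Fact sub_ballEmdist (x : set_type Y) (r : R) :
  ball x r = [set y | sub_mdist x y < r].
Proof.
have -> : ball x r = [set y | ball (\val x) r (\val y)] by [].
by rewrite ballEmdist.
Qed.

HB.instance Definition _ := @PseudoMetric_isMetric.Build R (set_type Y)
  sub_mdist sub_mdist_ge0 sub_mdist_positivity sub_ballEmdist.

End SubspaceMetric.

(* Discreteness is topological: the distances between distinct points need not
   be bounded away from 0. *)
Definition discrete_metric (R : realType) (X : metricType R) : Prop :=
  forall x : X, open [set x].

Definition bounded_geometry (R : realType) (X : metricType R) : Prop :=
  forall r : R, 0 < r ->
    exists N : nat, forall x : X, ([set y : X | mdist y x <= r] #<= `I_N)%card.

Definition fsymdiff (K : choiceType) (A B : {fset K}) : {fset K} :=
  ((A `\` B) `|` (B `\` A))%fset.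

(* The first conjunct is needed because division by 0 yields 0. *)
Definition symdiff_ratio_lt (R : realType) (K : choiceType) (e : R)
    (A B : {fset K}) : Prop :=
  (A `&` B)%fset != fset0 /\
  (#|` fsymdiff A B|)%:R / (#|` (A `&` B)%fset|)%:R < e.

Definition property_A (R : realType) (X : metricType R) : Prop :=
  forall r e : R, 0 < r -> 0 < e ->
    exists A : X -> {fset X * nat},
      [/\ forall x, A x != fset0,
          forall x y, mdist x y <= r -> symdiff_ratio_lt e (A x) (A y)
        & exists2 S : R, 0 < S &
            forall x y n, (y, n) \in A x -> mdist x y <= S].

Definition naive_property_A (R : realType) (X : metricType R) : Prop :=
  forall r e : R, 0 < r -> 0 < e ->
    exists A : X -> {fset X},
      [/\ forall x, A x != fset0,
          forall x y, mdist x y <= r -> symdiff_ratio_lt e (A x) (A y)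
        & exists2 S : R, 0 < S & forall x y, y \in A x -> mdist x y <= S].

(* Main.v *)
Require Import Defs.
From HB Require Import structures.
From mathcomp Require Import all_boot all_order all_algebra.
From mathcomp Require Import finmap zify ring lra.
From mathcomp Require Import boolp classical_sets functions cardinality.
From mathcomp Require Import reals topology.

Set Implicit Arguments.
Unset Strict Implicit.
Unset Printing Implicit Defensive.

Import Order.TTheory GRing.Theory Num.Theory.

Local Open Scope classical_set_scope.
Local Open Scope ring_scope.

(** The two properties differ in that property A allows multiplicities, and
    multiplicities cost nothing once the space is replaced by [X * nat].

    If naive property A and property A coincide, then heredity reduces to the
    heredity of property A, which is easy ([property_A_isometry]): push the sets
    A_x forward along a map [p : X -> Y] sending each point near [Y] to a nearby
    point of [Y].  Since [X] is countable, the extra coordinate in [nat] can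
    record where a point came from, so that the push-forward is injective and
    leaves all cardinalities unchanged.

    Conversely, naive property A always implies property A.  If [X] has
    property A and bounded geometry, then the tower [X * nat], with the maximum
    metric, has bounded geometry and naive property A
    ([naive_property_A_tower]); as [X] is isometric to the ground floor of the
    tower, heredity gives naive property A for [X].  For the tower, let
    [density (A x)] be the image in [X] of the uniform probability on A_x.
    Property A says that nearby points have densities close in l^1
    ([density_l1_dist]).  For a large integer [M], over each [y] in the support
    put a column of about [M * density (A x) y] integers starting at height [n];
    the union of these columns ([skyline]) is the set attached to [(x, n)].  It
    lies within distance [S + M] of [(x, n)] and has about [M] elements, whereas
    moving [(x, n)] by at most [r] changes it by a small multiple of [M], coming
    from the l^1 distance, plus a bounded number for each of the boundedly many
    columns, coming from rounding and from the shift in height. *)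

(** * Discreteness and bounded geometry *)

Lemma discrete_metricP (R : realType) (X : metricType R) :
  discrete_metric X <->
  forall x : X, exists2 e : R, 0 < e & forall y, mdist x y < e -> y = x.
Proof.
split=> [dX x|dX x].
  have /nbhs_ballP[e /= e0 xe] : nbhs x [set x] by apply: open_nbhs_nbhs.
  by exists e => // y xy; apply: xe; rewrite ballEmdist.
rewrite openE => _ ->; have [e e0 xe] := dX x.
by apply/nbhs_ballP; exists e => //= y; rewrite ballEmdist => /xe.
Qed.

Lemma card_le_IP (T : Type) (A : set T) (N : nat) :
  (A #<= `I_N)%card <->
  exists2 g : T -> nat, (forall x, A x -> (g x < N)%N) & set_inj A g.
Proof. split=> [/pcard_leP/injfunPex[g gN gA]|[g gN gA]]; first by exists g.
by apply/pcard_leP/injfunPex; exists g. Qed.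

Lemma card_fset_le (T : choiceType) (A : set T) (N : nat) (D : {fset T}) :
  (A #<= `I_N)%card -> (forall x, x \in D -> A x) -> (#|` D| <= N)%N.
Proof.
move=> /card_le_IP[g gN gA] DA.
have gD : {in D &, injective g}.
  by move=> x y xD yD; apply: gA; rewrite inE; exact: DA.
rewrite -(card_in_imfset imfset_key gD) -[leqRHS](size_iota 0).
apply: uniq_leq_size => // _ /imfsetP[x /= xD ->].
by rewrite mem_iota /= add0n gN//; exact: DA.
Qed.

(** A space of bounded geometry is the union of the finite balls of integer
    radius about one of its points. *)
Lemma bounded_geometry_countable (R : realType) (X : metricType R) :
  bounded_geometry X -> countable [set: X].
Proof.
move=> bX; have [->|/set0P[x0 _]] := eqVneq [set: X] set0; first exact: countable0.
have -> : [set: X] = \bigcup_(n in [set: nat]) [set y | mdist y x0 <= n.+1%:R].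
  apply/seteqP; split=> // y _; exists (Num.truncn (mdist y x0)) => //=.
  by rewrite ltW// truncnS_gt.
apply: bigcup_countable => // n _; have [//|N /(_ x0) xN] := bX n.+1%:R.
exact: sub_countable xN _.
Qed.

(** * Symmetric differences of finite sets *)

Section Fsymdiff.
Context {K : choiceType}.
Implicit Types A B C : {fset K}.

Lemma card_fsymdiff A B :
  #|` fsymdiff A B| = (#|` (A `\` B)%fset| + #|` (B `\` A)%fset|)%N.
Proof.
have AB0 : ((A `\` B) `&` (B `\` A) = fset0)%fset.
  by apply/fsetP => x; rewrite !inE; case: (x \in A); case: (x \in B).
by rewrite /fsymdiff cardfsU AB0 cardfs0 subn0.
Qed.

Lemma fsymdiffC A B : fsymdiff A B = fsymdiff B A.
Proof. by rewrite /fsymdiff fsetUC. Qed.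

Lemma leq_card_fsymdiff A B : (#|` A| <= #|` B| + #|` fsymdiff A B|)%N.
Proof.
rewrite card_fsymdiff -(cardfsID B A).
have := fsubset_leq_card (fsubsetIr A B); lia.
Qed.

Lemma card_fsetI_fsymdiff A B :
  (#|` A| <= #|` (A `&` B)%fset| + #|` fsymdiff A B|)%N.
Proof. by rewrite card_fsymdiff -(cardfsID B A); lia. Qed.

(** Since [#|` A| <= #|` A `&` B| + #|` fsymdiff A B|], comparing the symmetric
    difference with [A] instead of the intersection only turns [e] into
    [e / (1 + e)]; sums over [A] are easier to estimate than sums over the
    intersection. *)
Lemma symdiff_ratio_lt_card (R : realType) (e : R) A B : 0 < e ->
  (1 + e) * #|` fsymdiff A B|%:R < e * #|` A|%:R -> symdiff_ratio_lt e A B.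
Proof.
move=> e0 AB; have := card_fsetI_fsymdiff A B.
rewrite -(ler_nat R) natrD => AIB.
have I0 : 0 < (#|` (A `&` B)%fset|%:R : R).
  have : 0 <= (#|` fsymdiff A B|%:R : R) by [].
  nra.
split; first by rewrite -cardfs_gt0 -(ltr_nat R).
by rewrite ltr_pdivrMr//; nra.
Qed.

Lemma symdiff_ratio_lt_cardl (R : realType) (e : R) A B :
  symdiff_ratio_lt e A B -> 0 < e -> #|` fsymdiff A B|%:R <= e * #|` A|%:R.
Proof.
move=> [I0 +] e0; rewrite ltr_pdivrMr; last by rewrite ltr0n cardfs_gt0.
move=> /ltW/le_trans; apply; rewrite ler_pM2l// ler_nat.
by apply: fsubset_leq_card; exact: fsubsetIl.
Qed.

End Fsymdiff.

Lemma symdiff_ratio_lt_imfset (R : realType) (K L : choiceType) (f : K -> L)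
    (e : R) (A B : {fset K}) :
  injective f -> symdiff_ratio_lt e A B ->
  symdiff_ratio_lt e (f @` A)%fset (f @` B)%fset.
Proof.
move=> fI [AB0 ABe].
have DE (C D : {fset K}) :
    ((f @` C) `\` (f @` D))%fset = (f @` (C `\` D))%fset.
  apply/fsetP => y; apply/fsetDP/imfsetP => /= [[/imfsetP[x /= xC ->] xD]|].
    by exists x => //; rewrite inE xC andbT; apply: contra xD; exact: in_imfset.
  by move=> [x /fsetDP[xC xD] ->]; rewrite !mem_imfset.
rewrite /symdiff_ratio_lt /fsymdiff !DE -imfsetU -imfsetI;
  last by move=> ? ? _ _ /fI.
split; last by rewrite !(card_imfset _ _ fI).
by have /fset0Pn[x xAB] := AB0; apply/fset0Pn; exists (f x); exact: in_imfset.
Qed.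

(** * Transfer along isometric embeddings *)

Definition mdist_preserving (R : realType) (X Y : metricType R) (f : X -> Y) :=
  forall x y, mdist (f x) (f y) = mdist x y.

Section Isometry.
Context {R : realType} {X Y : metricType R}.
Variable f : Y -> X.
Hypothesis f_iso : mdist_preserving f.

Lemma mdist_preserving_inj : injective f.
Proof.
by move=> x y fxy; apply: mdist_positivity; rewrite -f_iso fxy mdistxx.
Qed.

Lemma discrete_metric_isometry : discrete_metric X -> discrete_metric Y.
Proof.
move=> /discrete_metricP dX; apply/discrete_metricP => y.
have [e e0 fye] := dX (f y); exists e => // z yz.
by apply: mdist_preserving_inj; apply: fye; rewrite f_iso.
Qed.

Lemma bounded_geometry_isometry : bounded_geometry X -> bounded_geometry Y.
Proof.
move=> bX r /bX[N rN]; exists N => y.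
have /card_le_IP[g gN gI] := rN (f y).
apply/card_le_IP; exists (g \o f) => [z /= zy|z t].
  by apply: gN => /=; rewrite f_iso.
rewrite !inE /= => zy ty gzt; apply: mdist_preserving_inj.
by apply: gI => //; rewrite inE /= f_iso.
Qed.

Lemma naive_property_A_isometry (g : X -> Y) :
  cancel g f -> naive_property_A Y -> naive_property_A X.
Proof.
move=> gK nY r e r0 e0; have [A [A0 Ae [S S0 AS]]] := nY r e r0 e0.
have g_iso x x' : mdist (g x) (g x') = mdist x x' by rewrite -f_iso !gK.
exists (fun x => (f @` A (g x))%fset); split.
- move=> x; have /fset0Pn[y yA] := A0 (g x).
  by apply/fset0Pn; exists (f y); exact: in_imfset.
- move=> x x' xx'; apply: symdiff_ratio_lt_imfset mdist_preserving_inj _.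
  by apply: Ae; rewrite g_iso.
- exists S => // x _ /imfsetP[y /= yA ->].
  by rewrite -[x]gK f_iso; exact: AS.
Qed.

(** The sets of [X] are pushed into [Y * nat] by an injective map: the first
    coordinate moves a point within [S] of [Y] to a point of [Y] within [S] of it,
    the second one stores the original point, by countability of [X]. *)
Lemma property_A_isometry :
  countable [set: X] -> property_A X -> property_A Y.
Proof.
move=> /countable_injP[c cI] pX r e r0 e0.
have [[y0]|Y0] := pselect (inhabited Y); last first.
  have noY (y : Y) : False by apply: Y0.
  exists (fun=> fset0); split=> [y|y|]; [by case: (noY y)..|].
  by exists 1 => // y; case: (noY y).
have [A [A0 Ae [S S0 AS]]] := pX r e r0 e0.
have /choice[p pS] (x : X) :
    exists z : Y, forall y, mdist (f y) x <= S -> mdist (f z) x <= S.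
  (* If [x] is far from the image of [f], the condition on [z] is vacuous. *)
  have [[z zx]|nz] := pselect (exists z, mdist (f z) x <= S); first by exists z.
  by exists y0 => y yx; case: nz; exists y.
pose code (z : X * nat) := (p z.1, choice.pickle (c z.1, z.2)).
have codeI : injective code.
  move=> [x m] [x' m'] [_ /(pcan_inj choice.pickleK)[cx ->]].
  by congr pair; apply: cI; rewrite ?inE.
exists (fun y => (code @` A (f y))%fset); split.
- move=> y; have /fset0Pn[z zA] := A0 (f y).
  by apply/fset0Pn; exists (code z); exact: in_imfset.
- by move=> y y' yy'; apply: symdiff_ratio_lt_imfset => //; apply: Ae; rewrite f_iso.
- exists (S + S) => [|y _ _ /imfsetP[[x m] /= xA [-> _]]]; first exact: addr_gt0.
  have yx := AS _ _ _ xA; rewrite -f_iso (le_trans (metric_triangle _ x _))//.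
  by rewrite lerD// metric_sym (pS x y).
Qed.

End Isometry.

Lemma naive_property_A_property_A (R : realType) (X : metricType R) :
  naive_property_A X -> property_A X.
Proof.
move=> nX r e r0 e0; have [A [A0 Ae [S S0 AS]]] := nX r e r0 e0.
exists (fun x => ((fun y => (y, 0%N)) @` A x)%fset); split.
- move=> x; have /fset0Pn[y yA] := A0 x.
  by apply/fset0Pn; exists (y, 0%N); apply/imfsetP; exists y.
- by move=> x y xy; apply: symdiff_ratio_lt_imfset; [move=> ? ? []|exact: Ae].
- by exists S => // x y n /imfsetP[z /= zA [-> _]]; exact: AS.
Qed.

(** * Densities of finite subsets of a product *)

Section FiberCount.
Context {T S : choiceType}.
Implicit Types A B : {fset T * S}.

Definition fiber_count A (y : T) : nat := #|` [fset z in A | z.1 == y]%fset|.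

Lemma sum_fiber_count A (D : {fset T}) : (forall z, z \in A -> z.1 \in D) ->
  (\sum_(y <- D) fiber_count A y)%N = #|` A|.
Proof.
move=> AD; under eq_bigr do rewrite /fiber_count card_fset_sum1 -big_fset_condE.
rewrite (exchange_big_dep xpredT)//= card_fset_sum1 big_seq [RHS]big_seq.
apply: eq_bigr => z /AD zD; rewrite (eq_bigl (pred1 z.1)) => [|y]; last exact: eq_sym.
by rewrite -big_filter filter_pred1_uniq// big_seq1.
Qed.

Lemma fiber_count_fsymdiff A B y :
  (fiber_count A y <= fiber_count B y + fiber_count (fsymdiff A B) y)%N.
Proof.
apply: leq_trans (leq_card_fsetU _ _); apply: fsubset_leq_card.
apply/fsubsetP => z; rewrite !inE /= => /andP[-> ->]; rewrite !andbT.
by case: (z \in B).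
Qed.

Lemma fiber_count0 A y : y \notin (fst @` A)%fset -> fiber_count A y = 0%N.
Proof.
move=> yA; apply/eqP; rewrite cardfs_eq0; apply: contraNT yA => /fset0Pn[z].
by rewrite !inE /= => /andP[zA /eqP <-]; exact: in_imfset.
Qed.

Variable R : realType.

(** The image under the first projection of the uniform probability on [A]. *)
Definition density A (y : T) : R := (fiber_count A y)%:R / #|` A|%:R.

Lemma density_ge0 A y : 0 <= density A y.
Proof. by rewrite divr_ge0. Qed.

Lemma sum_density A (D : {fset T}) : A != fset0 ->
  (forall z, z \in A -> z.1 \in D) -> \sum_(y <- D) density A y = 1.
Proof.
move=> A0 AD; rewrite -mulr_suml -natr_sum sum_fiber_count// divff//.
by rewrite pnatr_eq0 cardfs_eq0.
Qed.

Lemma density_le1 A y : A != fset0 -> density A y <= 1.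
Proof.
move=> A0; rewrite ler_pdivrMr ?mul1r ?ltr0n ?cardfs_gt0// ler_nat.
by apply: fsubset_leq_card; apply/fsubsetP => z; rewrite !inE => /andP[].
Qed.

(** One half of the bound comes from the difference of the fiber counts, the
    other from the difference of the normalizing factors [#|A|] and [#|B|]; both
    are controlled by the symmetric difference. *)
Lemma density_l1_dist A B (D : {fset T}) (d : R) : A != fset0 -> B != fset0 ->
  (forall z, z \in A -> z.1 \in D) -> (forall z, z \in B -> z.1 \in D) ->
  #|` fsymdiff A B|%:R <= d * #|` A|%:R ->
  \sum_(y <- D) `|density A y - density B y| <= 2 * d.
Proof.
move=> A0 B0 AD BD ABd.
have a0 : 0 < (#|` A|%:R : R) by rewrite ltr0n cardfs_gt0.
have b0 : 0 < (#|` B|%:R : R) by rewrite ltr0n cardfs_gt0.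
have SD z : z \in fsymdiff A B -> z.1 \in D.
  by rewrite !inE => /orP[/andP[_ /AD]|/andP[_ /BD]].
have AB1 : `|#|` B|%:R - #|` A|%:R| <= #|` fsymdiff A B|%:R :> R.
  have := leq_card_fsymdiff A B; have := leq_card_fsymdiff B A.
  rewrite (fsymdiffC B) -!(ler_nat R) !natrD ler_norml => ? ?.
  by apply/andP; split; lra.
pose c y : R := (fiber_count (fsymdiff A B) y)%:R.
have le_y y : `|density A y - density B y| <=
    (c y + density B y * `|#|` B|%:R - #|` A|%:R|) / #|` A|%:R.
  have -> : density A y - density B y =
      ((fiber_count A y)%:R - (fiber_count B y)%:R
        + density B y * (#|` B|%:R - #|` A|%:R)) / #|` A|%:R.
    by rewrite /density; field; rewrite !gt_eqF.
  rewrite normrM normfV (gtr0_norm a0) ler_pM2r ?invr_gt0//.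
  rewrite (le_trans (ler_normD _ _))// normrM (ger0_norm (density_ge0 _ _)) lerD2r.
  have := fiber_count_fsymdiff A B y; have := fiber_count_fsymdiff B A y.
  rewrite (fsymdiffC B) -!(ler_nat R) !natrD ler_norml => ? ?.
  by apply/andP; split; rewrite /c; lra.
apply: le_trans (ler_sum _ (fun y _ => le_y y)) _.
rewrite -mulr_suml big_split/= -mulr_suml -natr_sum sum_fiber_count//.
rewrite sum_density// mul1r ler_pdivrMr//; lra.
Qed.

End FiberCount.

(** * Unions of columns *)

Section Skyline.
Context {T : choiceType}.
Implicit Types (D : {fset T}) (h : T -> nat) (n : nat).

Definition skyline D h n : {fset T * nat} :=
  [fset z in [seq (y, m) | y <- D, m <- iota n (h y)]]%fset.

Lemma mem_skyline D h n y m :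
  ((y, m) \in skyline D h n) = (y \in D) && (n <= m < n + h y)%N.
Proof.
rewrite !inE /=; apply/allpairsPdep/andP => [[z [k [zD + [-> ->]]]]|[yD ym]].
  by rewrite mem_iota.
by exists y, m; rewrite mem_iota.
Qed.

Lemma card_skyline D h n : #|` skyline D h n| = (\sum_(y <- D) h y)%N.
Proof.
rewrite card_fseq undup_id ?size_allpairs_dep.
  by rewrite sumnE big_map; apply: eq_bigr => y _; rewrite size_iota.
apply: allpairs_uniq_dep => //; first by move=> y _; exact: iota_uniq.
by move=> [y m] [y' m'] _ _ /= [-> ->].
Qed.

Lemma skyline_widen D E h n : (D `<=` E)%fset ->
  (forall y, y \notin D -> h y = 0%N) -> skyline D h n = skyline E h n.
Proof.
move=> DE h0; apply/fsetP => -[y m]; rewrite !mem_skyline.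
have [yD|/h0 ->] := boolP (y \in D); first by rewrite (fsubsetP DE).
by rewrite addn0; case: ltngtP; rewrite ?andbF.
Qed.

Lemma card_skylineD D h h' n n' :
  (#|` (skyline D h n `\` skyline D h' n')%fset|
   <= \sum_(y <- D) ((n' - n) + ((n + h y) - (n' + h' y))))%N.
Proof.
pose s y := iota n (n' - n) ++ iota (n' + h' y) ((n + h y) - (n' + h' y)).
have -> : (\sum_(y <- D) ((n' - n) + ((n + h y) - (n' + h' y))))%N =
    size [seq (y, m) | y <- D, m <- s y].
  rewrite size_allpairs_dep sumnE big_map; apply: eq_bigr => y _.
  by rewrite size_cat !size_iota.
apply: uniq_leq_size => // -[y m]; rewrite in_fsetD !mem_skyline => /andP[+ /andP[yD]].
rewrite yD /= => m' mh; apply/allpairsPdep; exists y, m; split=> //.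
by rewrite mem_cat !mem_iota; lia.
Qed.

Lemma card_skyline_fsymdiff (R : realType) D h h' n n' :
  #|` fsymdiff (skyline D h n) (skyline D h' n')|%:R <=
  \sum_(y <- D) (2 * `|n%:R - n'%:R| + `|(h y)%:R - (h' y)%:R|) :> R.
Proof.
have natdist (a b : nat) : `|a%:R - b%:R| = ((a - b) + (b - a))%N%:R :> R.
  by case: (leqP a b) => [|/ltnW] ab; [rewrite distrC|];
    rewrite -natrB// ger0_norm//; congr _%:R; lia.
under eq_bigr do rewrite !natdist -natrM -natrD.
rewrite -natr_sum ler_nat card_fsymdiff.
apply: leq_trans (leq_add (card_skylineD _ _ _ _ _) (card_skylineD _ _ _ _ _)) _.
by rewrite -big_split /=; apply: leq_sum => y _; lia.
Qed.

End Skyline.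

(** * The tower over a metric space *)

(** An alias, so that it can carry the maximum metric independently of any
    structure that the product already has. *)
Definition tower (R : realType) (X : metricType R) : Type := (X * nat)%type.

Section TowerMetric.
Context {R : realType} {X : metricType R}.

HB.instance Definition _ := Choice.copy (tower X) (X * nat)%type.

Definition tower_dist (x y : tower X) : R :=
  Num.max (mdist x.1 y.1) `|x.2%:R - y.2%:R|.

Fact tower_distxx x : tower_dist x x = 0.
Proof. by rewrite /tower_dist mdistxx subrr normr0 maxxx. Qed.

Fact tower_dist_positivity x y : tower_dist x y = 0 -> x = y.
Proof.
case: x y => [x n] [y m] /eqP; rewrite /tower_dist eq_le ge_max /=.
move=> /andP[/andP[xy nm] _].
congr pair; first by apply: mdist_positivity; apply/eqP; rewrite eq_le xy mdist_ge0.
by move: nm; rewrite normr_le0 subr_eq0 eqr_nat => /eqP.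
Qed.

Fact tower_dist_sym x y : tower_dist x y = tower_dist y x.
Proof. by rewrite /tower_dist metric_sym distrC. Qed.

Fact tower_dist_triangle y x z : tower_dist x z <= tower_dist x y + tower_dist y z.
Proof.
rewrite /tower_dist ge_max; apply/andP; split.
  apply: le_trans (metric_triangle _ y.1 _) _.
  by apply: lerD; rewrite le_max lexx.
by apply: le_trans (ler_distD y.2%:R _ _) _; apply: lerD; rewrite le_max lexx orbT.
Qed.

HB.instance Definition _ := @isMetric.Build R (tower X) tower_dist
  tower_distxx tower_dist_positivity tower_dist_sym tower_dist_triangle.

Lemma mdist_tower_leP (x y : tower X) (r : R) :
  reflect (mdist x.1 y.1 <= r /\ `|x.2%:R - y.2%:R| <= r) (mdist x y <= r).
Proof.
have -> : (mdist x y <= r) = (mdist x.1 y.1 <= r) && (`|x.2%:R - y.2%:R| <= r).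
  by rewrite -ge_max.
exact: andP.
Qed.

End TowerMetric.

Section TowerGeometry.
Context {R : realType}.
Variable X : metricType R.

Lemma discrete_metric_tower : discrete_metric X -> discrete_metric (tower X).
Proof.
move=> /discrete_metricP dX; apply/discrete_metricP => -[x n].
have [e e0 xe] := dX x; exists (Num.min e 1) => [|[y m]].
  by rewrite lt_min e0 ltr01.
rewrite lt_min => /andP[]; rewrite /mdist/= /tower_dist !gt_max /=.
move=> /andP[/xe -> _] /andP[_]; rewrite ltr_norml => /andP[nm mn]; congr pair.
have : n%:R < (m.+1)%:R :> R by rewrite -natr1; lra.
have : m%:R < (n.+1)%:R :> R by rewrite -natr1; lra.
by rewrite !ltr_nat; lia.
Qed.

(** A ball in the tower lies in the product of a ball of [X], numbered by [g],
    and an interval of length [2 * k < K], numbered by residues modulo [K]. *)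
Lemma bounded_geometry_tower : bounded_geometry X -> bounded_geometry (tower X).
Proof.
move=> bX r r0; have [N rN] := bX r r0.
pose k := Num.truncn r; pose K := (k + k).+1.
have close_eq u v : u = v %[mod K] -> (u <= v)%N -> (v <= u + k + k)%N -> u = v.
  move=> /esym/eqP + uv vu; rewrite eqn_mod_dvd// => Kuv.
  apply/eqP; rewrite eqn_leq uv -subn_eq0 eqn0Ngt; apply: contraL Kuv => uv0.
  by rewrite gtnNdvd// /K ltnS leq_subLR addnA.
have near (n m : nat) : `|m%:R - n%:R| <= r -> (m <= n + k)%N && (n <= m + k)%N.
  rewrite ler_norml => /andP[nm mn]; have := truncnS_gt r; rewrite -/k -natr1 => rk.
  have : m%:R < (n + k).+1%:R :> R by rewrite -natr1 natrD; lra.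
  have : n%:R < (m + k).+1%:R :> R by rewrite -natr1 natrD; lra.
  by rewrite !ltr_nat !ltnS => -> ->.
exists (N * K)%N => -[x n]; have /card_le_IP[g gN gI] := rN x.
apply/card_le_IP; exists (fun z => (g z.1 * K + z.2 %% K)%N) => [[y m]|[y m] [y' m']] /=.
  move=> /mdist_tower_leP[/gN gy _].
  by apply: leq_trans (leq_mul gy (leqnn K)); rewrite mulSn addnC ltn_add2r ltn_pmod.
rewrite !inE => /mdist_tower_leP[/= yx /near nm] /mdist_tower_leP[/= yx' /near nm'] eqg.
have gE : g y = g y'.
  have := congr1 (divn^~ K) eqg.
  by rewrite /= !divnMDl// !(divn_small (ltn_pmod _ _))// !addn0.
congr pair; first by apply: gI; rewrite ?inE.
have := congr1 (modn^~ K) eqg; rewrite /= !modnMDl !modn_mod => mm'.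
move: nm nm' => /andP[nm mn] /andP[nm' mn'].
case: (leqP m m') => [|/ltnW] le; [|symmetry]; apply: close_eq => //.
  exact: leq_trans nm' (leq_add mn (leqnn k)).
exact: leq_trans nm (leq_add mn' (leqnn k)).
Qed.

(** The set attached to [(x, n)] is the skyline of heights
    [M * density (A x)], rounded down, starting at level [n]. *)
Lemma naive_property_A_tower :
  bounded_geometry X -> property_A X -> naive_property_A (tower X).
Proof.
move=> bX pX r e r0 e0.
(* With this [d], the l^1 distance of the densities, multiplied by [(1 + e) * M],
   is at most [e * M / 2], one half of the main term of [e * #|B|]. *)
pose d := e / (4 * (1 + e)).
have d0 : 0 < d by rewrite divr_gt0//; lra.
have [A [A0 Ad [S S0 AS]]] := pX r d r0 d0.
have [C SC] := bX S S0.
(* [M > q] says that the other half dominates the errors independent of [M]: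
   at most [2 * r + 1] for each of the at most [2 * C] columns, and the loss
   of at most [C] elements in [B] by rounding. *)
pose q : R := ((1 + e) * ((2 * r + 1) * (2 * C%:R)) + e * C%:R) * 2 / e.
pose M := (Num.truncn q).+1.
have qM : q < M%:R := truncnS_gt q.
pose D x : {fset X} := (fst @` A x)%fset.
have AD x z : z \in A x -> z.1 \in D x by exact: in_imfset.
have DC x : (#|` D x| <= C)%N.
  apply: (card_fset_le (SC x)) => _ /imfsetP[[y n] /= /AS xy ->] /=.
  by rewrite metric_sym.
pose h x y := Num.truncn (M%:R * density R (A x) y).
have hle x y : (h x y)%:R <= M%:R * density R (A x) y.
  by rewrite truncn_le mulr_ge0// density_ge0.
have hgt x y : M%:R * density R (A x) y - 1 <= (h x y)%:R.
  by rewrite lerBlDr natr1 ltW// truncnS_gt.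
have h0 x y : y \notin D x -> h x y = 0%N.
  by move=> yD; rewrite /h /density fiber_count0// mul0r mulr0 truncn0.
have hM x y : (h x y <= M)%N.
  rewrite -(ler_nat R) (le_trans (hle x y))//.
  by rewrite -[leRHS]mulr1 ler_wpM2l// density_le1.
pose B (z : tower X) : {fset tower X} := skyline (D z.1) (h z.1) z.2.
have Bratio z z' : mdist z z' <= r -> symdiff_ratio_lt e (B z) (B z').
  case: z z' => [x n] [x' n']; move=> /mdist_tower_leP[/= xx' nn'].
  apply: symdiff_ratio_lt_card => //.
  have cardB : M%:R - C%:R <= #|` B (x, n)|%:R :> R.
    rewrite /B card_skyline /= natr_sum.
    apply: le_trans (ler_sum _ (fun y _ => hgt x y)).
    rewrite sumrB -mulr_sumr sum_density ?mulr1//; last exact: AD.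
    by rewrite lerD2l lerN2 -(natr_sum _ _ _ (fun=> 1%N)) -card_fset_sum1 ler_nat.
  pose E := (D x `|` D x')%fset.
  have EC : #|` E|%:R <= 2 * C%:R :> R.
    rewrite -natrM ler_nat (leq_trans (leq_card_fsetU _ _))//.
    by have := DC x; have := DC x'; lia.
  have sumE : #|` fsymdiff (B (x, n)) (B (x', n'))|%:R <=
      M%:R * (2 * d) + (2 * r + 1) * #|` E|%:R.
    rewrite /B /= (skyline_widen n (fsubsetUl (D x) (D x')) (h0 x)).
    rewrite (skyline_widen n' (fsubsetUr (D x) (D x')) (h0 x')) -/E.
    apply: le_trans (card_skyline_fsymdiff _ _ _ _ _ _) _.
    have le_y y : 2 * `|n%:R - n'%:R| + `|(h x y)%:R - (h x' y)%:R| <=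
        M%:R * `|density R (A x) y - density R (A x') y| + (2 * r + 1).
      suff : `|(h x y)%:R - (h x' y)%:R| <=
        M%:R * `|density R (A x) y - density R (A x') y| + 1 by lra.
      rewrite -[X in X * _](@ger0_norm R)// -normrM mulrBr.
      have := hle x y; have := hle x' y; have := hgt x y; have := hgt x' y.
      rewrite ler_norml; set u := _ * density _ (A x) y; set v := _ * density _ (A x') y.
      have := ler_norm (u - v); have := ler_norm (v - u); rewrite (distrC v).
      by move=> *; apply/andP; split; lra.
    apply: le_trans (ler_sum _ (fun y _ => le_y y)) _.
    rewrite big_split/= -mulr_sumr; apply: lerD.
      apply: ler_wpM2l => //; apply: density_l1_dist => //.
      - by move=> w /AD wD; rewrite inE wD.
      - by move=> w /AD wD; rewrite inE wD orbT.
      - exact: symdiff_ratio_lt_cardl (Ad _ _ xx') d0.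
    by rewrite card_fset_sum1 natr_sum mulr_sumr; apply: ler_sum => y _; rewrite mulr1.
  have dE : (1 + e) * (M%:R * (2 * d)) = e * M%:R / 2.
    by rewrite /d; field; rewrite gt_eqF//; lra.
  have qE : (1 + e) * ((2 * r + 1) * (2 * C%:R)) + e * C%:R < e * M%:R / 2.
    by move: qM; rewrite /q ltr_pdivrMr//; lra.
  have : (1 + e) * #|` fsymdiff (B (x, n)) (B (x', n'))|%:R <=
      (1 + e) * (M%:R * (2 * d) + (2 * r + 1) * (2 * C%:R)).
    rewrite ler_pM2l; last lra.
    by rewrite (le_trans sumE)// lerD2l ler_pM2l//; lra.
  have : e * (M%:R - C%:R) <= e * #|` B (x, n)|%:R by rewrite ler_pM2l.
  lra.
exists B; split => //.
- move=> z; have [|+ _] := Bratio z z; first by rewrite mdistxx ltW.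
  by rewrite fsetIid.
- exists (S + M%:R) => [|[x n] [y m]]; first by rewrite ltr_wpDr.
  rewrite mem_skyline /= => /andP[/imfsetP[[y' k] /= /AS xy ->] nm].
  apply/mdist_tower_leP => /=; split; first by rewrite (le_trans xy)// lerDl.
  have mM : m%:R <= n%:R + M%:R :> R by rewrite -natrD ler_nat; have := hM x y'; lia.
  have nm' : n%:R <= m%:R :> R by rewrite ler_nat; lia.
  by rewrite ler_norml; apply/andP; split; lra.
Qed.

End TowerGeometry.

Theorem theoremC (R : realType) :
  (forall X : metricType R,
     discrete_metric X -> bounded_geometry X ->
     (naive_property_A X <-> property_A X))
  <->
  (forall X : metricType R,
     discrete_metric X -> bounded_geometry X -> naive_property_A X ->
     forall Y : set X, naive_property_A (set_type Y)).
Proof.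
split=> [naiveA X dX bX nX Y|hered X dX bX].
  have Yiso : mdist_preserving (\val : set_type Y -> X) by [].
  apply/naiveA; [exact: discrete_metric_isometry Yiso dX
    |exact: bounded_geometry_isometry Yiso bX|].
  apply: property_A_isometry Yiso (bounded_geometry_countable bX) _.
  exact/naiveA.
split=> [|pX]; first exact: naive_property_A_property_A.
(* [X] is isometric to the ground floor of its tower. *)
pose ground : set (tower X) := [set z | z.2 = 0%N].
have nG := hered _ (discrete_metric_tower dX) (bounded_geometry_tower bX)
  (naive_property_A_tower bX pX) ground.
pose f (z : set_type ground) : X := (\val z).1.
have g0 x : (x, 0%N) \in ground by rewrite inE.
pose g x : set_type ground := exist _ (x, 0%N : nat) (g0 x).
apply: (@naive_property_A_isometry _ _ _ f _ g) nG => // -[[x n] xg] [[y m] yg].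
have n0 : n = 0%N := set_mem xg; have m0 : m = 0%N := set_mem yg; subst n m.
by rewrite /mdist /= /sub_mdist /mdist /= /tower_dist /= subrr normr0 max_l// mdist_ge0.
Qed.
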